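(* Let $Q$ be a groupoid with a two-sided neutral element $1$ and right inverses, that is, $1\cdot x = x\cdot 1 = x$ for every $x\in Q$, and for every $x\in Q$ there is $x'\in Q$ with $x\cdot x' = 1$. If $Q$ satisfies the left Bol identity $(x\cdot (y\cdot x))\cdot z = x\cdot (y\cdot (x\cdot z))$ for all $x,y,z\in Q$, then $Q$ is a loop.
   Context: A groupoid here is a set with a single binary operation $\cdot$ (no further axioms). A loop is a groupoid with a two-sided neutral element in which every equation $x\cdot y = z$ has a unique solution whenever two of the elements $x,y,z$ are specified; equivalently, there is a two-sided neutral element and all left translations $y\mapsto x\cdot y$ and all right translations $y\mapsto y\cdot x$ are bijections. *)

(* Defs.v *)
From mathcomp Require Import all_boot.

Set Implicit Arguments.
Unset Strict Implicit.
Unset Printing Implicit Defensive.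

(* A groupoid (magma) is a carrier [Q : Type] with a bare operation [mul];
   MathComp's [magmaType] is not used because it demands a [choiceType]. *)

Definition is_neutral (Q : Type) (mul : Q -> Q -> Q) (e : Q) : Prop :=
  left_id e mul /\ right_id e mul.

Definition has_right_inverses (Q : Type) (mul : Q -> Q -> Q) (e : Q) : Prop :=
  forall x : Q, exists x' : Q, mul x x' = e.

Definition left_bol (Q : Type) (mul : Q -> Q -> Q) : Prop :=
  forall x y z : Q, mul (mul x (mul y x)) z = mul x (mul y (mul x z)).

(* Unique solvability of [mul x y = z] in [z] holds in every magma, so only
   the equations in [y] and in [x] are required. *)
Definition is_loop (Q : Type) (mul : Q -> Q -> Q) : Prop :=
  [/\ exists e : Q, is_neutral mul e,
      forall x z : Q, exists! y : Q, mul x y = z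
    & forall y z : Q, exists! x : Q, mul x y = z].

(* Main.v *)
Require Import Defs.
From mathcomp Require Import all_boot.

Set Implicit Arguments.
Unset Strict Implicit.
Unset Printing Implicit Defensive.

(** Write [L x] for the left translation by [x].  The left Bol identity reads
    [L (x (y x)) = L x o L y o L x].  Let [x a = 1].
    - Since [a (x a) = a], the Bol identity says [L a = L a o L x o L a];
      evaluating it at a right inverse of [a] gives [a x = 1], so inverses are two-sided
      ([right_inverse_left]).
    - With [y = a a] one gets [y x = a (a x) = a], hence [x (y x) = x a = 1] and
      [id = L 1 = L x o L (a a) o L x = L x o L a o L a o L x].
      So [L x] is onto; exchanging [x] and [a], [L a] is onto too.  Together
      with [L a o L x o L a = L a] this makes [L a o L x] the identity
      ([left_inverse_property]), so left translations are bijective.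
    - For right division, [y x = z] amounts to [x (y x) = x z], that is
      [L x o L y o L x = L (x z)]; evaluation at [a] determines [y] as
      [a ((x z) a)], and the Bol identity shows that this [y] is a solution. *)

Lemma right_inverse_left (Q : Type) (mul : Q -> Q -> Q) (one : Q) :
  is_neutral mul one -> has_right_inverses mul one -> left_bol mul ->
  forall x a, mul x a = one -> mul a x = one.
Proof.
move=> [_ mul1r] rinv bol x a xa1; have [b ab1] := rinv a.
by have := bol a x b; rewrite xa1 mul1r ab1 mul1r => <-.
Qed.

(** Since [(a a) x = a], the product [x ((a a) x)] is [1], so the Bol identity
    writes the identity map as a composite that begins and ends with [L x]:
    this is the source of all cancellation. *)
Lemma inverse_square_sandwich (Q : Type) (mul : Q -> Q -> Q) (one : Q) :
  is_neutral mul one -> left_bol mul ->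
  forall x a, mul x a = one -> mul a x = one ->
  forall z, mul x (mul a (mul a (mul x z))) = z.
Proof.
move=> [mul1l mul1r] bol x a xa1 ax1 z.
have sqE w : mul (mul a a) w = mul a (mul a w).
  by have := bol a one w; rewrite !mul1l.
by have := bol x (mul a a) z; rewrite !sqE ax1 mul1r xa1 mul1l.
Qed.

(** [L a o L x] fixes every element of the image of [L a], and
    [inverse_square_sandwich] for the pair [(a, x)] puts every element there. *)
Lemma left_inverse_property (Q : Type) (mul : Q -> Q -> Q) (one : Q) :
  is_neutral mul one -> left_bol mul ->
  forall x a, mul x a = one -> mul a x = one ->
  forall z, mul a (mul x z) = z.
Proof.
move=> neutral bol x a xa1 ax1 z.
rewrite -(inverse_square_sandwich neutral bol ax1 xa1 z).
by rewrite -[in LHS]bol xa1 neutral.2.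
Qed.

Theorem theorem6p5 (Q : Type) (mul : Q -> Q -> Q) (one : Q)
  (h_neutral : is_neutral mul one)
  (h_rinv : has_right_inverses mul one)
  (h_bol : left_bol mul) :
  is_loop mul.
Proof.
have [mul1l mul1r] := h_neutral.
split=> [|x z|x z]; first by exists one.
all: have [a xa1] := h_rinv x.
all: have ax1 := right_inverse_left h_neutral h_rinv h_bol xa1.
all: have mulKa := left_inverse_property h_neutral h_bol xa1 ax1.
all: have mulKx := left_inverse_property h_neutral h_bol ax1 xa1.
  by exists (mul a z); split=> [|y <-]; rewrite ?mulKx ?mulKa.
exists (mul a (mul (mul x z) a)); split=> [|y <-].
  by rewrite h_bol ax1 mul1r mulKa.
by rewrite h_bol xa1 mul1r mulKa.
Qed.
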